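(* Let $(\mathcal C,p)$ be a universe category with universe $p:\widetilde U\to U$, let $CC=CC(\mathcal C,p)$ and let $n\ge 2$. The functions $u_{n,\Gamma}:\mathcal{O}b_n(\Gamma)\to D_p^{n-1}(Yo(U))(int(\Gamma))$, $\Gamma\in CC$, defined by recursion on $n$ starting from $u_1$ by $$u_{m+1,\Gamma}(T)=(u_{1,\Gamma}(ft^m(T)),\,u_{m,ft^m(T)}(T)),\qquad m\ge 1,$$ are well defined and form an isomorphism of presheaves on $CC$ $$u_n:\mathcal{O}b_n\to int^{\circ}(D_p^{n-1}(Yo(U))).$$
   Context: Conventions. Composition is written in diagrammatic order: for $f:X\to Y$, $g:Y\to Z$ the composite is $f\circ g:X\to Z$. $\amalg_{i\in I}A_i$ denotes the set of pairs $(i,a)$, $i\in I$, $a\in A_i$. $Yo$ is the Yoneda embedding, $Yo(Y)(X)=Mor(X,Y)$. For a functor $\Phi:C\to C'$ and a presheaf $\mathcal G$ on $C'$, $\Phi^{\circ}(\mathcal G)(X)=\mathcal G(\Phi(X))$. Universes. A universe in a category $\mathcal C$ is a morphism $p:\widetilde U\to U$ with a choice, for every $F:X\to U$, of a pullback square with vertex $(X;F)$ and projections $p_F:(X;F)\to X$, $Q(F):(X;F)\to\widetilde U$, $p_F\circ F=Q(F)\circ p$. For $f:X'\to X$ and $F:X\to U$, $Q(f,F):(X';f\circ F)\to(X;F)$ is the unique morphism with $Q(f,F)\circ p_F=p_{f\circ F}\circ f$ and $Q(f,F)\circ Q(F)=Q(f\circ F)$. A universe category $(\mathcal C,p)$ is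 a category with a universe $p$ and a chosen final object $pt$. The functor $D_p:PreShv(\mathcal C)\to PreShv(\mathcal C)$. $D_p(\mathcal G)(X)=\amalg_{F:X\to U}\mathcal G((X;F))$; for $f:X'\to X$, $D_p(\mathcal G)(f)(F,\gamma)=(f\circ F,\mathcal G(Q(f,F))(\gamma))$; for $r:\mathcal G\to\mathcal G'$, $D_p(r)_X(F,\gamma)=(F,r_{(X;F)}(\gamma))$. $D_p^n$ is its $n$-th iterate, $D_p^0=Id$, $D_p^{n+1}(\mathcal G)=D_p(D_p^n(\mathcal G))$. The C-system $CC(\mathcal C,p)$. Define recursively sets $Ob_n(\mathcal C,p)$ and functions $int:Ob_n(\mathcal C,p)\to Ob(\mathcal C)$: $Ob_0(\mathcal C,p)=\{tt\}$, $int(tt)=pt$; $Ob_{n+1}(\mathcal C,p)=\amalg_{A\in Ob_n(\mathcal C,p)}Mor_{\mathcal C}(int(A),U)$, $int(A,F)=(int(A);F)$. Objects of $CC(\mathcal C,p)$ are pairs $\Gamma=(n,A)$ with $A\in Ob_n(\mathcal C,p)$, and $int(\Gamma)=int(A)$. Morphisms $\Gamma'\to\Gamma$ are (copies of) the morphisms $int(\Gamma')\to int(\Gamma)$ of $\mathcal C$, so that $int:CC(\mathcal C,p)\to\mathcal C$ is a fully faithful functor. Set $l(n,A)=n$, $ft(n+1,(A,F))=(n,A)$, $ft(0,tt)=(0,tt)$; for $T=(n+1,(A,F))$ and $f:(n',A')\to(n,A)$, $f^*(T)=(n'+1,(A',int(f)\circ F))$ and $q(f,T):f^*(T)\to T$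 is the morphism with $int(q(f,T))=Q(int(f),F)$. The presheaves $\mathcal{O}b_n$ on $CC(\mathcal C,p)$. $\mathcal{O}b_n(\Gamma)=\{T\mid l(T)=l(\Gamma)+n,\ ft^n(T)=\Gamma\}$. For $f:\Gamma'\to\Gamma$ and $T\in\mathcal{O}b_n(\Gamma)$ define recursively in $n$: for $n=0$, $f^*(T)=\Gamma'$, $q(f,T)=f$; for $n\ge1$, $f^*(T)=q(f,ft(T))^*(T)$ and $q(f,T)=q(q(f,ft(T)),T)$. Then $\mathcal{O}b_n(f)(T)=f^*(T)$. The isomorphism $u_1:\mathcal{O}b_1\to int^\circ(Yo(U))$ is given, for $\Gamma=(n,A)$ and $T=(n+1,(A,F))$, by $u_{1,\Gamma}(T)=F$; thus $int(T)=(int(\Gamma);u_{1,\Gamma}(T))$. *)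

(* Defs.v *)
From mathcomp Require Import all_boot.
From Stdlib Require Import ProofIrrelevance IndefiniteDescription.

Set Implicit Arguments.
Unset Strict Implicit.
Unset Printing Implicit Defensive.

Declare Scope cat_scope.
Delimit Scope cat_scope with cat.

Record category := Category {
  cat_ob :> Type;
  Mor : cat_ob -> cat_ob -> Type;
  idm : forall X, Mor X X;
  compm : forall X Y Z, Mor X Y -> Mor Y Z -> Mor X Z;
  comp1m : forall X Y (f : Mor X Y), compm (idm X) f = f;
  compm1 : forall X Y (f : Mor X Y), compm f (idm Y) = f;
  compmA : forall X Y Z W (f : Mor X Y) (g : Mor Y Z) (h : Mor Z W),
    compm f (compm g h) = compm (compm f g) h }.
Arguments Mor {c} X Y.
Arguments idm {c} X.
Arguments compm {c X Y Z} f g.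

(* Diagrammatic order: [f \; g] is first [f], then [g]. *)
Notation "f \; g" := (compm f g) : cat_scope.
Local Open Scope cat_scope.

Record functor (C D : category) := Functor {
  fob :> C -> D;
  fmor : forall X Y, Mor X Y -> Mor (fob X) (fob Y);
  fmor1 : forall X, fmor (idm X) = idm (fob X);
  fmorM : forall X Y Z (f : Mor X Y) (g : Mor Y Z),
    fmor (f \; g) = fmor f \; fmor g }.

Record presheaf (C : category) := Presheaf {
  psh_ob :> C -> Type;
  psh_mor : forall X' X, Mor X' X -> psh_ob X -> psh_ob X';
  psh_mor1 : forall X (x : psh_ob X), psh_mor (idm X) x = x;
  psh_morM : forall X'' X' X (g : Mor X'' X') (f : Mor X' X) (x : psh_ob X),
    psh_mor (g \; f) x = psh_mor g (psh_mor f x) }.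
Arguments psh_mor {C} p {X' X} f x.

Record psh_hom (C : category) (F G : presheaf C) := PshHom {
  psh_app :> forall X, F X -> G X;
  psh_nat : forall X' X (f : Mor X' X) (x : F X),
    psh_app (psh_mor F f x) = psh_mor G f (psh_app x) }.

(* The family [phi] is (the underlying family of) an isomorphism [F -> G] in
   the category of presheaves. *)
Definition psh_iso (C : category) (F G : presheaf C)
    (phi : forall X, F X -> G X) : Prop :=
  exists (r : psh_hom F G) (s : psh_hom G F),
    (forall X (x : F X), r X x = phi X x) /\
    (forall X (x : F X), s X (r X x) = x) /\
    (forall X (y : G X), r X (s X y) = y).

Definition Yo (C : category) (Y : C) : presheaf C :=
  @Presheaf C (fun X => Mor X Y) (fun _ _ f g => f \; g)
    (fun _ g => comp1m g) (fun _ _ _ g f h => esym (compmA g f h)).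

Lemma psh_pre1 (C D : category) (Phi : functor C D) (G : presheaf D) X
  (x : G (Phi X)) : psh_mor G (fmor Phi (idm X)) x = x.
Proof. by rewrite fmor1 psh_mor1. Qed.

Lemma psh_preM (C D : category) (Phi : functor C D) (G : presheaf D)
    X'' X' X (g : Mor X'' X') (f : Mor X' X) (x : G (Phi X)) :
  psh_mor G (fmor Phi (g \; f)) x =
  psh_mor G (fmor Phi g) (psh_mor G (fmor Phi f) x).
Proof. by rewrite fmorM psh_morM. Qed.

(* Restriction of [G] along [Phi], i.e. [X |-> G (Phi X)]. *)
Definition psh_pre (C D : category) (Phi : functor C D) (G : presheaf D) :
    presheaf C :=
  @Presheaf C (fun X => G (Phi X)) (fun _ _ f x => psh_mor G (fmor Phi f) x)
    (@psh_pre1 C D Phi G) (@psh_preM C D Phi G).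

Definition is_pullback (C : category) (P A B D : C) (a : Mor P A) (b : Mor P B)
    (f : Mor A D) (g : Mor B D) : Prop :=
  a \; f = b \; g /\
  forall (Z : C) (x : Mor Z A) (y : Mor Z B), x \; f = y \; g ->
    exists! h : Mor Z P, h \; a = x /\ h \; b = y.

Record universe (C : category) := Universe {
  uU : C;
  uUt : C;
  up : Mor uUt uU;
  pb_ob : forall X, Mor X uU -> C;
  pb_p : forall X (F : Mor X uU), Mor (pb_ob F) X;
  pb_Q : forall X (F : Mor X uU), Mor (pb_ob F) uUt;
  pb_pullback : forall X (F : Mor X uU), is_pullback (pb_p F) (pb_Q F) F up }.

Record universe_category := UniverseCategory {
  uc_cat :> category;
  uc_univ : universe uc_cat;
  uc_pt : uc_cat;
  uc_final : forall X : uc_cat, exists! f : Mor X uc_pt, True }.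

Notation UU C := (uU (uc_univ C)).

Lemma pb_map_ex (C : universe_category) (X' X : C) (f : Mor X' X)
    (F : Mor X (UU C)) :
  exists! h : Mor (pb_ob (f \; F)) (pb_ob F),
    h \; pb_p F = pb_p (f \; F) \; f /\
    h \; pb_Q F = pb_Q (f \; F).
Proof.
have [_ univ] := pb_pullback F; apply: univ.
by rewrite -compmA (proj1 (pb_pullback (f \; F))).
Qed.

(* [Q(f,F)], the morphism characterized by [pb_mapP]. *)
Definition pb_map (C : universe_category) (X' X : C) (f : Mor X' X)
    (F : Mor X (UU C)) : Mor (pb_ob (f \; F)) (pb_ob F) :=
  proj1_sig (constructive_definite_description _ (pb_map_ex f F)).

Lemma pb_mapP (C : universe_category) (X' X : C) (f : Mor X' X)
    (F : Mor X (UU C)) :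
  pb_map f F \; pb_p F = pb_p (f \; F) \; f /\
  pb_map f F \; pb_Q F = pb_Q (f \; F).
Proof.
exact: proj2_sig (constructive_definite_description _ (pb_map_ex f F)).
Qed.

Lemma pb_uniq (C : universe_category) (X Z : C) (F : Mor X (UU C))
    (h1 h2 : Mor Z (pb_ob F)) :
  h1 \; pb_p F = h2 \; pb_p F -> h1 \; pb_Q F = h2 \; pb_Q F ->
  h1 = h2.
Proof.
move=> e1 e2; have [sq univ] := pb_pullback F.
have [|h [_ hu]] := univ Z (h2 \; pb_p F) (h2 \; pb_Q F).
  by rewrite -!compmA sq.
by rewrite -(hu h1) // -(hu h2).
Qed.

Lemma Dp_eq (C : universe_category) (G : presheaf C) (X X1 : C)
    (F : Mor X (UU C)) (F1 F2 : Mor X1 (UU C))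
    (h1 : Mor (pb_ob F1) (pb_ob F)) (h2 : Mor (pb_ob F2) (pb_ob F)) (f : Mor X1 X)
    (x : G (pb_ob F)) :
  F1 = F2 ->
  h1 \; pb_p F = pb_p F1 \; f -> h1 \; pb_Q F = pb_Q F1 ->
  h2 \; pb_p F = pb_p F2 \; f -> h2 \; pb_Q F = pb_Q F2 ->
  existT (fun F' : Mor X1 (UU C) => G (pb_ob F')) F1 (psh_mor G h1 x) =
  existT _ F2 (psh_mor G h2 x).
Proof.
move=> eF; case: _ / eF h2 => h2 a1 b1 a2 b2.
suff -> : h1 = h2 by [].
by apply: pb_uniq; [rewrite a1 a2 | rewrite b1 b2].
Qed.

Definition Dp_mor (C : universe_category) (G : presheaf C) (X' X : C)
    (f : Mor X' X) (x : {F : Mor X (UU C) & G (pb_ob F)}) :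
    {F : Mor X' (UU C) & G (pb_ob F)} :=
  existT _ (f \; projT1 x) (psh_mor G (pb_map f (projT1 x)) (projT2 x)).

Lemma Dp_mor1 (C : universe_category) (G : presheaf C) (X : C)
    (x : {F : Mor X (UU C) & G (pb_ob F)}) : Dp_mor (idm X) x = x.
Proof.
case: x => F x; rewrite -[in RHS](psh_mor1 x) /Dp_mor /=.
have [a b] := pb_mapP (idm X) F.
by apply: (Dp_eq x (f := idm X)); rewrite ?a ?b ?comp1m ?compm1.
Qed.

Lemma Dp_morM (C : universe_category) (G : presheaf C) (X'' X' X : C)
    (g : Mor X'' X') (f : Mor X' X) (x : {F : Mor X (UU C) & G (pb_ob F)}) :
  Dp_mor (g \; f) x = Dp_mor g (Dp_mor f x).
Proof.
case: x => F x; rewrite /Dp_mor /= -psh_morM.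
have [a b] := pb_mapP (g \; f) F; have [a1 b1] := pb_mapP f F.
have [a2 b2] := pb_mapP g (f \; F).
apply: (Dp_eq x (f := g \; f)); rewrite ?a ?b //.
- by rewrite compmA.
- by rewrite -compmA a1 [LHS]compmA a2; apply: esym (compmA _ _ _).
- by rewrite -compmA b1 b2.
Qed.

(* [D_p(G)]; its elements over [X] are the pairs [(F, x)], [x] in [G((X;F))]. *)
Definition Dp (C : universe_category) (G : presheaf C) : presheaf C :=
  @Presheaf C (fun X => {F : Mor X (UU C) & G (pb_ob F)}) (@Dp_mor C G)
    (@Dp_mor1 C G) (@Dp_morM C G).

Definition Dp_iter (C : universe_category) (n : nat) (G : presheaf C) :
  presheaf C := iter n (@Dp C) G.

(* [Ob_n(C,p)] together with its function [int]. *)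
Fixpoint tower (C : universe_category) (n : nat) : {A : Type & A -> C} :=
  match n with
  | 0 => existT (fun A : Type => A -> C) unit (fun=> uc_pt C)
  | m.+1 =>
      existT (fun A : Type => A -> C)
        {A : projT1 (tower C m) & Mor (projT2 (tower C m) A) (UU C)}
        (fun AF => pb_ob (projT2 AF))
  end.

(* Primitive projections give [ft (ext G F) = G] by conversion. *)
Set Primitive Projections.
Record CC_ob (C : universe_category) :=
  CCOb { len : nat; tele : projT1 (tower C len) }.
Unset Primitive Projections.

Definition int_ob (C : universe_category) (G : CC_ob C) : C :=
  projT2 (tower C (len G)) (tele G).

Definition CC (C : universe_category) : category :=
  @Category (CC_ob C) (fun G' G => Mor (int_ob G') (int_ob G))
    (fun G => idm (int_ob G)) (fun _ _ _ f g => f \; g)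
    (fun _ _ f => comp1m f) (fun _ _ f => compm1 f)
    (fun _ _ _ _ f g h => compmA f g h).

Definition int (C : universe_category) : functor (CC C) C :=
  @Functor (CC C) C (@int_ob C) (fun _ _ f => f)
    (fun _ => erefl) (fun _ _ _ _ _ => erefl).

Definition ext (C : universe_category) (G : CC C) (F : Mor (int C G) (UU C)) :
  CC C := @CCOb C (len G).+1 (existT _ (tele G) F).

Definition ft (C : universe_category) (T : CC C) : CC C :=
  match len T as k return projT1 (tower C k) -> CC C with
  | 0 => fun A => @CCOb C 0 A
  | m.+1 => fun AF => @CCOb C m (projT1 AF)
  end (tele T).

(* The [F] of an object [T = (n+1, (A, F))]. *)
Definition top_mor (C : universe_category) (T : CC C) :
    0 < len T -> Mor (int C (ft T)) (UU C) :=
  let: CCOb k A := T in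
  match k as k return forall A : projT1 (tower C k),
    0 < k -> Mor (int C (ft (CCOb A))) (UU C) with
  | 0 => fun _ h => False_rect _ (notF h)
  | m.+1 => fun AF _ => projT2 AF
  end A.

(* [f^*(T)] and [q(f,T)] for [l(T) > 0] and [f : G' -> ft(T)]. *)
Definition star (C : universe_category) (T : CC C) (h : 0 < len T) (G' : CC C)
  (f : Mor G' (ft T)) : CC C := ext (fmor (int C) f \; top_mor h).

Definition qmor (C : universe_category) (T : CC C) :
    forall (h : 0 < len T) (G' : CC C) (f : Mor G' (ft T)), Mor (star h f) T :=
  let: CCOb k A := T in
  match k as k return forall A : projT1 (tower C k),
    forall (h : 0 < len (CCOb A)) (G' : CC C) (f : Mor G' (ft (CCOb A))),
      Mor (star h f) (CCOb A : CC C) with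
  | 0 => fun _ h => False_rect _ (notF h)
  | m.+1 => fun AF _ G' f => pb_map (fmor (int C) f) (projT2 AF)
  end A.

Definition Ob_set (C : universe_category) (n : nat) (G : CC C) : Type :=
  {T : CC C | len T = len G + n /\ iter n (@ft C) T = G}.

Lemma Ob_set_eq (C : universe_category) n (G : CC C) (T1 T2 : Ob_set n G) :
  sval T1 = sval T2 -> T1 = T2.
Proof.
case: T1 T2 => [T1 h1] [T2 h2] /= e; case: _ / e h2 => h2.
by rewrite (proof_irrelevance _ h1 h2).
Qed.

Lemma len_ft (C : universe_category) (T : CC C) : len (ft T) = (len T).-1.
Proof. by case: T => -[]. Qed.

Lemma len_ftn (C : universe_category) n (T : CC C) :
  len (iter n (@ft C) T) = len T - n.
Proof. by elim: n => [|n IH]; rewrite ?subn0 //= len_ft IH subnS. Qed.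

Lemma Ob_ft_subproof (C : universe_category) n (G : CC C) (T : Ob_set n.+1 G) :
  len (ft (sval T)) = len G + n /\ iter n (@ft C) (ft (sval T)) = G.
Proof. by case: T => T [e1 e2] /=; rewrite len_ft e1 addnS -iterSr. Qed.

Definition Ob_ft (C : universe_category) n (G : CC C) (T : Ob_set n.+1 G) :
  Ob_set n G := exist _ (ft (sval T)) (Ob_ft_subproof T).

Lemma Ob_gt0 (C : universe_category) n (G : CC C) (T : Ob_set n.+1 G) :
  0 < len (sval T).
Proof. by case: T => T [e1 e2] /=; rewrite e1 addnS. Qed.

(* The pair [f^*(T)], [q(f,T)], for [f : G' -> G] and [T] in [Ob_n(G)].  When
   [n = 0] the second component is [f], read as a morphism to [T = G]. *)
Fixpoint Ob_pull (C : universe_category) (n : nat) (G' G : CC C) (f : Mor G' G) :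
    forall T : Ob_set n G, {T' : CC C & Mor T' (sval T)} :=
  match n as n return
    forall T : Ob_set n G, {T' : CC C & Mor T' (sval T)} with
  | 0 => fun T =>
      existT _ G' (eq_rect G (fun X : CC C => Mor G' X) f (sval T)
                     (esym (proj2 (proj2_sig T))))
  | m.+1 => fun T =>
      let S := Ob_pull f (Ob_ft T) in
      existT _ (star (Ob_gt0 T) (projT2 S)) (qmor (Ob_gt0 T) (projT2 S))
  end.

Lemma Ob_star_subproof (C : universe_category) n (G' G : CC C) (f : Mor G' G)
    (T : Ob_set n G) :
  len (projT1 (Ob_pull f T)) = len G' + n /\
  iter n (@ft C) (projT1 (Ob_pull f T)) = G'.
Proof.
elim: n T => [|n IH] T; first by split=> //=; rewrite addn0.
have [e1 e2] := IH (Ob_ft T); rewrite iterSr.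
by split; [rewrite /= e1 addnS | exact: e2].
Qed.

Definition Ob_star (C : universe_category) n (G' G : CC C) (f : Mor G' G)
  (T : Ob_set n G) : Ob_set n G' :=
  exist _ (projT1 (Ob_pull f T)) (Ob_star_subproof f T).

Local Notation over T T' h := (existT (fun X : CC _ => Mor X T) T' h).

Lemma star_qmor_eq (C : universe_category) (T : CC C) (h : 0 < len T)
    (S1 S2 : {T' : CC C & Mor T' (ft T)}) : S1 = S2 ->
  over T (star h (projT2 S1)) (qmor h (projT2 S1)) =
  over T (star h (projT2 S2)) (qmor h (projT2 S2)).
Proof. by move->. Qed.

Lemma ext_eq (C : universe_category) (G0 G : CC C) (f : Mor G G0)
    (F : Mor (int C G0) (UU C)) (F1 F2 : Mor (int C G) (UU C))
    (h1 : Mor (pb_ob F1) (pb_ob F)) (h2 : Mor (pb_ob F2) (pb_ob F)) :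
  F1 = F2 ->
  h1 \; pb_p F = pb_p F1 \; f -> h1 \; pb_Q F = pb_Q F1 ->
  h2 \; pb_p F = pb_p F2 \; f -> h2 \; pb_Q F = pb_Q F2 ->
  over (ext F) (ext F1) h1 = over (ext F) (ext F2) h2.
Proof.
move=> eF; case: _ / eF h2 => h2 a1 b1 a2 b2.
suff -> : h1 = h2 by [].
by apply: pb_uniq; [rewrite a1 a2 | rewrite b1 b2].
Qed.

Lemma star_qmor1 (C : universe_category) (T : CC C) (h : 0 < len T) :
  over T (star h (idm (ft T))) (qmor h (idm (ft T))) = over T T (idm T).
Proof.
case: T h => -[|k] // [A F] h.
have [a b] := pb_mapP (idm (int_ob (CCOb A))) F.
apply: (@ext_eq C (CCOb A) (CCOb A) (idm (int_ob (CCOb A))) F _ F _ (idm _));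
  by [exact: comp1m | exact: a | exact: b | rewrite comp1m compm1
     | rewrite comp1m].
Qed.

Lemma star_qmorM (C : universe_category) (T : CC C) (h : 0 < len T)
    (G'' G' : CC C) (f : Mor G' (ft T)) (g : Mor G'' G')
    (h' : 0 < len (star h f)) :
  over T (star h (g \; f)) (qmor h (g \; f)) =
  over T (@star C (star h f) h' G'' g)
    (@qmor C (star h f) h' G'' g \; qmor h f).
Proof.
case: T h f h' => -[|k] // [A F] h f h'.
have [a b] := pb_mapP (compm (c := C) g f) F.
have [a1 b1] := pb_mapP (f : Mor (int_ob G') (int_ob (CCOb A))) F.
have [a2 b2] := pb_mapP (g : Mor (int_ob G'') (int_ob G')) (compm (c := C) f F).
apply: (@ext_eq C (CCOb A) G'' (compm (c := C) g f) F).
- exact: esym (compmA (c := C) _ _ _).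
- exact: a.
- exact: b.
- by rewrite /= -compmA a1 [LHS]compmA a2; apply: esym (compmA _ _ _).
- by rewrite /= -compmA b1 b2.
Qed.

Lemma Ob_pull1 (C : universe_category) n (G : CC C) (T : Ob_set n G) :
  Ob_pull (idm G) T = over (sval T) (sval T) (idm (sval T)).
Proof.
elim: n T => [|n IH] T.
  case: T => T [/= e1 e2]; destruct e2 => /=.
  by rewrite (proof_irrelevance _ (esym _) erefl).
by rewrite /= (star_qmor_eq (Ob_gt0 T) (IH (Ob_ft T))) star_qmor1.
Qed.

Lemma Ob_pullM (C : universe_category) n (G'' G' G : CC C) (g : Mor G'' G')
    (f : Mor G' G) (T : Ob_set n G) :
  Ob_pull (g \; f) T =
  over (sval T) (sval (Ob_star g (Ob_star f T)))
    (projT2 (Ob_pull g (Ob_star f T)) \; projT2 (Ob_pull f T)).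
Proof.
elim: n T => [|n IH] T.
  case: T => T [/= e1 e2]; destruct e2 => /=.
  rewrite (proof_irrelevance _ (esym (proj2 (conj e1 _))) erefl).
  by rewrite (proof_irrelevance _ (esym _) erefl).
have := star_qmor_eq (Ob_gt0 T) (IH (Ob_ft T)).
rewrite (star_qmorM _ (Ob_gt0 (Ob_star f T))) => e; apply: etrans e _.
pose S := Ob_pull f (Ob_ft T).
pose H p := let R := Ob_pull g (exist _ (projT1 S) p : Ob_set n G') in
  over (sval T) (@star C (sval (Ob_star f T)) (Ob_gt0 (Ob_star f T)) _ (projT2 R))
    (@qmor C (sval (Ob_star f T)) (Ob_gt0 (Ob_star f T)) _ (projT2 R) \;
     qmor (Ob_gt0 T) (projT2 S)).
exact: (congr1 H (proof_irrelevance _ (Ob_star_subproof f (Ob_ft T))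
  (Ob_ft_subproof (Ob_star f T)))).
Qed.

Lemma Ob_star1 (C : universe_category) n (G : CC C) (T : Ob_set n G) :
  Ob_star (idm G) T = T.
Proof. by apply: Ob_set_eq; rewrite /= Ob_pull1. Qed.

Lemma Ob_starM (C : universe_category) n (G'' G' G : CC C) (g : Mor G'' G')
    (f : Mor G' G) (T : Ob_set n G) :
  Ob_star (g \; f) T = Ob_star g (Ob_star f T).
Proof. by apply: Ob_set_eq; rewrite /= Ob_pullM. Qed.

Definition Ob_psh (C : universe_category) (n : nat) : presheaf (CC C) :=
  @Presheaf (CC C) (Ob_set n) (@Ob_star C n) (@Ob_star1 C n) (@Ob_starM C n).

(* The equality [ft(T) = G] makes the [F] of [T] a morphism [int(G) -> U]. *)
Definition u1 (C : universe_category) (G : CC C) (T : Ob_set 1 G) :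
    Mor (int C G) (UU C) :=
  eq_rect (ft (sval T)) (fun X => Mor (int C X) (UU C)) (top_mor (Ob_gt0 T))
    G (proj2 (proj2_sig T)).

Lemma int_Ob1 (C : universe_category) (G : CC C) (T : Ob_set 1 G) :
  int C (sval T) = pb_ob (u1 T).
Proof.
rewrite /u1; move: (Ob_gt0 T) (proj2 (proj2_sig T)); case: T => T eT /= h e.
by destruct e => /=; case: T h {eT} => -[].
Qed.

Lemma Ob_bot_subproof (C : universe_category) m (G : CC C)
    (T : Ob_set m.+1 G) :
  len (iter m (@ft C) (sval T)) = len G + 1 /\
  iter 1 (@ft C) (iter m (@ft C) (sval T)) = G.
Proof.
by case: T => T [e1 e2] /=; rewrite len_ftn e1 addnS -addSn addnK addn1.
Qed.

(* [ft^m(T)], as an element of [Ob_1(G)]. *)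
Definition Ob_bot (C : universe_category) m (G : CC C) (T : Ob_set m.+1 G) :
  Ob_set 1 G := exist _ (iter m (@ft C) (sval T)) (Ob_bot_subproof T).

Lemma Ob_top_subproof (C : universe_category) m (G : CC C)
    (T : Ob_set m.+1 G) :
  len (sval T) = len (sval (Ob_bot T)) + m /\
  iter m (@ft C) (sval T) = sval (Ob_bot T).
Proof.
split=> //; rewrite (proj1 (Ob_bot_subproof T)).
by case: T => T [e1 e2] /=; rewrite e1 addn1 addSn addnS.
Qed.

(* [T], as an element of [Ob_m(ft^m(T))]. *)
Definition Ob_top (C : universe_category) m (G : CC C) (T : Ob_set m.+1 G) :
  Ob_set m (sval (Ob_bot T)) := exist _ (sval T) (Ob_top_subproof T).

Definition u_family (C : universe_category) : Type :=
  forall n, 0 < n -> forall G : CC C,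
    Ob_psh C n G -> psh_pre (int C) (Dp_iter n.-1 (Yo (UU C))) G.

(* The second component of [u_{m+1}(T)] is [u_m(T)] for [T] over [ft^m(T)],
   carried along the equality [int(ft^m(T)) = (int(G); u_1(ft^m(T)))].  As
   [m >= 1], the clause is written with [m.+1] for [m]. *)
Definition u_rec (C : universe_category) (u : u_family C) : Prop :=
  (forall (G : CC C) (T : Ob_psh C 1 G), u 1 isT G T = u1 T) /\
  (forall (m : nat) (G : CC C) (T : Ob_psh C m.+2 G),
     u m.+2 isT G T =
     existT (fun F : Mor (int C G) (UU C) => Dp_iter m (Yo (UU C)) (pb_ob F))
       (u1 (Ob_bot T))
       (eq_rect (int C (sval (Ob_bot T))) (Dp_iter m (Yo (UU C)))
          (u m.+1 isT (sval (Ob_bot T)) (Ob_top T))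
          (pb_ob (u1 (Ob_bot T))) (int_Ob1 (Ob_bot T)))).

(* Main.v *)
Require Import Defs.
From mathcomp Require Import all_boot.
From Stdlib Require Import ProofIrrelevance.

Set Implicit Arguments.
Unset Strict Implicit.
Unset Printing Implicit Defensive.

Local Open Scope cat_scope.

(** Both sides of [u_n] are built from bottom to top by the same recursion.
    An element of [Ob_{m+1}(G)] is the same thing as a morphism
    [F : int(G) -> U] together with an element [S] of [Ob_m] over the extended
    object [ext F]; call it [Ob_cons F S].  An element of [D_p^{m+1}(Yo(U))]
    over [int(G)] is a pair of such an [F] and an element of [D_p^m(Yo(U))]
    over [(int(G);F)], which is [int(ext F)] by conversion.  In these terms

    - [u] is [Ob_cons F S |-> (F, u S)] ([u_succ_cons]), so it is bijective, the
      inverse being the recursive replacement of pairs by [Ob_cons];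
    - pulling back along [f] is
      [Ob_cons F S |-> Ob_cons (f \; F) (Q(f,F)^* S)] ([Ob_star_cons]), which is
      the formula for the action of [f] on [D_p], so [u] is natural.

    The recursive clause that defines [u] transports along the equality
    [int(ft^m(T)) = (int(G); u_1(ft^m(T)))].  On an [Ob_cons F S] the
    object [ft^m(T)] is [ext F], so that the equality is reflexivity up to proof
    irrelevance ([u_succ_transport]); after that no argument meets a
    transport. *)

Section Cons.
Variable C : universe_category.

Lemma Ob_cons_subproof m (G : CC C) (F : Mor (int C G) (UU C))
    (S : Ob_set m (ext F)) :
  len (sval S) = len G + m.+1 /\ iter m.+1 (@ft C) (sval S) = G.
Proof. by case: S => T [e1 e2] /=; rewrite e1 e2 addnS. Qed.

Definition Ob_cons m (G : CC C) (F : Mor (int C G) (UU C))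
    (S : Ob_set m (ext F)) : Ob_set m.+1 G :=
  exist _ (sval S) (Ob_cons_subproof S).

Lemma ext_top_mor (T : CC C) (h : 0 < len T) : ext (top_mor h) = T.
Proof. by case: T h => -[|k] // [A F]. Qed.

(** [F] is the last component of [ft^m(T)], which lies one step above [G]; the
    object itself does not change, only the base over which it is read. *)
Lemma Ob_consP m (G : CC C) (T : Ob_set m.+1 G) :
  exists (F : Mor (int C G) (UU C)) (S : Ob_set m (ext F)), T = Ob_cons S.
Proof.
have h := Ob_gt0 (Ob_bot T).
have eT : iter m (@ft C) (sval T) = ext (top_mor h) by rewrite ext_top_mor.
have lT : m <= len (sval T).
  by case: (svalP T) => -> _; rewrite addnS ltnW // ltnS leq_addl.
have := proj2 (svalP (Ob_bot T)).
case: T h eT lT => T hT /= h eT lT eG; destruct eG.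
exists (top_mor h).
have hS : len T = len (ext (top_mor h)) + m /\
          iter m (@ft C) T = ext (top_mor h).
  by split=> //; rewrite -eT len_ftn subnK.
by exists (exist _ T hS); apply: Ob_set_eq.
Qed.

Definition Ob_id (G : CC C) : Ob_set 0 G :=
  exist _ G (conj (esym (addn0 (len G))) erefl).

Lemma Ob_set0 (G : CC C) (S : Ob_set 0 G) : S = Ob_id G.
Proof. by apply: Ob_set_eq; case: S => T [e1 e2]. Qed.

(** Pullback is computed one step of the tower at a time, from the bottom, so
    it may be resumed at the first stage [B]: pulling [T] back along [f] is
    pulling [T] back along [q(f,B)].  The element of [Ob] is given by its
    underlying object, in order that both sides be pairs over that object. *)
Lemma Ob_pull_bot m (G' G : CC C) (f : Mor G' G) (B : Ob_set 1 G) (T : CC C)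
    (h : len T = len G + m.+1 /\ iter m.+1 (@ft C) T = G)
    (hB : len T = len (sval B) + m /\ iter m (@ft C) T = sval B) :
  Ob_pull f (exist _ T h : Ob_set m.+1 G) =
  Ob_pull (projT2 (Ob_pull f B)) (exist _ T hB : Ob_set m (sval B)).
Proof.
elim: m T h hB => [|m IH] T h hB.
  case: B hB => B eB [e1 /= e2]; destruct e2.
  by rewrite (proof_irrelevance _ eB h) (proof_irrelevance _ (esym _) erefl).
set TG : Ob_set m.+2 G := exist _ T h.
set TB : Ob_set m.+1 (sval B) := exist _ T hB.
have := IH _ (Ob_ft_subproof TG) (Ob_ft_subproof TB).
move/(star_qmor_eq (Ob_gt0 TG)) => e; apply: etrans e _.
by rewrite (bool_irrelevance (Ob_gt0 TG) (Ob_gt0 TB)).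
Qed.

(** The first stage of [f^*(T)] is [ext (f \; F)], with [q(f, ext F) = Q(f,F)];
    resuming the pullback there ([Ob_pull_bot]) gives the rest.  The right-hand
    side has the shape of the action of [f] on [D_p]. *)
Lemma Ob_star_cons m (G' G : CC C) (f : Mor G' G) (F : Mor (int C G) (UU C))
    (S : Ob_set m (ext F)) :
  Ob_star f (Ob_cons S) =
  Ob_cons (Ob_star (pb_map (fmor (int C) f) F :
                      Mor (ext (fmor (int C) f \; F)) (ext F)) S).
Proof.
apply: Ob_set_eq; case: S => T hS.
pose B : Ob_set 1 G := Ob_cons (Ob_id (ext F)).
apply: etrans (congr1 (fun S => projT1 S) (Ob_pull_bot f (B := B) _ hS)) _.
(* The first stage of the pullback of [B] is [f] itself, up to a transport
   along an equality between [ft (ext F)] and the identical [G]. *)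
by rewrite /= (proof_irrelevance _ (esym _) erefl).
Qed.

End Cons.

Section Family.
Variable C : universe_category.

(** [u_succ m] is [u_{m+1}]: the shift of index leaves a plain recursion without
    the side condition that the index be positive. *)
Fixpoint u_succ m (G : CC C) : Ob_set m.+1 G -> Dp_iter m (Yo (UU C)) (int C G) :=
  match m return Ob_set m.+1 G -> Dp_iter m (Yo (UU C)) (int C G) with
  | 0 => @u1 C G
  | m'.+1 => fun T =>
     existT (fun F : Mor (int C G) (UU C) => Dp_iter m' (Yo (UU C)) (pb_ob F))
       (u1 (Ob_bot T))
       (eq_rect (int C (sval (Ob_bot T))) (Dp_iter m' (Yo (UU C)))
          (u_succ (Ob_top T)) (pb_ob (u1 (Ob_bot T))) (int_Ob1 (Ob_bot T)))
  end.

Definition u_fam : u_family C := fun n =>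
  match n with
  | 0 => fun h => False_rect _ (notF h)
  | m.+1 => fun _ G T => u_succ T
  end.

Lemma u1_ext (G : CC C) (F : Mor (int C G) (UU C)) (B : Ob_set 1 G) :
  sval B = ext F -> u1 B = F.
Proof.
case: B => B eB /= e; rewrite /u1; move: (Ob_gt0 _) (proj2 _) => /=.
by rewrite e => h e'; rewrite (proof_irrelevance _ e' erefl).
Qed.

(** The pair in the clause for [u_{m+2}], with an arbitrary element [B] of
    [Ob_1] over the first stage in place of [ft^{m+1}(T)]: once [B] is [ext F],
    the equality of objects along which the second component is carried has
    convertible sides, and the transport disappears by proof irrelevance. *)
Lemma u_succ_transport m (G : CC C) (F : Mor (int C G) (UU C)) (B : Ob_set 1 G)
    (T : CC C) (hB : len T = len (sval B) + m.+1 /\ iter m.+1 (@ft C) T = sval B)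
    (hF : len T = len (ext F) + m.+1 /\ iter m.+1 (@ft C) T = ext F) :
  existT (fun F : Mor (int C G) (UU C) => Dp_iter m (Yo (UU C)) (pb_ob F))
    (u1 B)
    (eq_rect (int C (sval B)) (Dp_iter m (Yo (UU C)))
       (u_succ (exist _ T hB : Ob_set m.+1 (sval B))) (pb_ob (u1 B)) (int_Ob1 B)) =
  existT (fun F : Mor (int C G) (UU C) => Dp_iter m (Yo (UU C)) (pb_ob F))
    F (u_succ (exist _ T hF : Ob_set m.+1 (ext F))).
Proof.
have eB : sval B = ext F by rewrite -(proj2 hB) -(proj2 hF).
move: (int_Ob1 B); rewrite (u1_ext eB); case: B eB hB => B h /= eB.
rewrite eB => hB e; rewrite (proof_irrelevance _ e erefl) /=.
by rewrite (proof_irrelevance _ hB hF).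
Qed.

Lemma u_succ_cons m (G : CC C) (F : Mor (int C G) (UU C))
    (S : Ob_set m.+1 (ext F)) :
  u_succ (Ob_cons S) =
  existT (fun F : Mor (int C G) (UU C) => Dp_iter m (Yo (UU C)) (pb_ob F))
    F (u_succ S).
Proof. by case: S => T hS; apply: u_succ_transport. Qed.

Fixpoint u_inv m : forall G : CC C,
    Dp_iter m (Yo (UU C)) (int C G) -> Ob_set m.+1 G :=
  match m with
  | 0 => fun G F => Ob_cons (Ob_id (ext F))
  | m'.+1 => fun G x => Ob_cons (@u_inv m' (ext (projT1 x)) (projT2 x))
  end.

Lemma u_succK m (G : CC C) (T : Ob_set m.+1 G) : u_inv (u_succ T) = T.
Proof.
elim: m G T => [|m IH] G T; have [F [S ->]] := Ob_consP T.
  by rewrite /= (Ob_set0 S) (@u1_ext G F).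
by rewrite u_succ_cons /= IH.
Qed.

Lemma u_invK m (G : CC C) (x : Dp_iter m (Yo (UU C)) (int C G)) :
  u_succ (u_inv x) = x.
Proof.
elim: m G x => [|m IH] G x; first exact: u1_ext.
by case: x => F x; rewrite [u_inv _]/= u_succ_cons IH.
Qed.

Lemma u_succ_nat m (G' G : CC C) (f : Mor G' G) (T : Ob_set m.+1 G) :
  u_succ (Ob_star f T) =
  psh_mor (Dp_iter m (Yo (UU C))) (fmor (int C) f) (u_succ T).
Proof.
elim: m G' G f T => [|m IH] G' G f T; have [F [S ->]] := Ob_consP T.
  rewrite Ob_star_cons (Ob_set0 S) (Ob_set0 (Ob_star _ _)) /=.
  by rewrite (u1_ext (F := fmor (int C) f \; F)) // (u1_ext (F := F)).
by rewrite Ob_star_cons !u_succ_cons IH.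
Qed.

Lemma u_fam_rec : u_rec u_fam.
Proof. by []. Qed.

Lemma u_rec_uniq (u' : u_family C) : u_rec u' ->
  forall m (hm : 0 < m) (G : CC C) (T : Ob_psh C m G), u' m hm G T = u_fam hm T.
Proof.
move=> [u'1 u'S]; elim=> // -[|m] IH hm G T; rewrite (bool_irrelevance hm isT).
  exact: u'1.
by rewrite u'S (IH isT).
Qed.

End Family.

(** Naturality has to be checked in one direction only: bijectivity transfers it
    to the inverse. *)
Lemma psh_iso_bij (C : category) (F G : presheaf C)
    (phi : forall X, F X -> G X) (psi : forall X, G X -> F X) :
  (forall X' X (f : Mor X' X) (x : F X),
     phi _ (psh_mor F f x) = psh_mor G f (phi _ x)) ->
  (forall X, cancel (phi X) (psi X)) -> (forall X, cancel (psi X) (phi X)) ->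
  psh_iso phi.
Proof.
move=> nat phiK psiK.
have psi_nat X' X (f : Mor X' X) (y : G X) :
    psi _ (psh_mor G f y) = psh_mor F f (psi _ y).
  by rewrite -{1}[y]psiK -nat phiK.
by exists (PshHom nat), (PshHom psi_nat).
Qed.

Theorem mainTheorem6 (C : universe_category) (n : nat) (hn : 2 <= n) :
  exists u : u_family C,
    u_rec u /\
    (forall u' : u_family C, u_rec u' ->
       forall (m : nat) (hm : 0 < m) (G : CC C) (T : Ob_psh C m G),
         u' m hm G T = u m hm G T) /\
    @psh_iso (CC C) (Ob_psh C n)
      (psh_pre (int C) (Dp_iter n.-1 (Yo (UU C)))) (u n (ltnW hn)).
Proof.
exists (@u_fam C); split; [exact: u_fam_rec | split; first exact: u_rec_uniq].
case: n hn => // m hn.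
exact: (@psh_iso_bij (CC C) (Ob_psh C m.+1)
  (psh_pre (int C) (Dp_iter m (Yo (UU C)))) (fun G T => u_succ T)
  (fun G x => u_inv x) (@u_succ_nat C m) (@u_succK C m) (@u_invK C m)).
Qed.
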